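(* Let $A,B_1,\dots,B_m\in\mathbb{R}^{n\times n}$ be symmetric matrices, $\mathbf{a},\mathbf{b}_1,\dots,\mathbf{b}_m\in\mathbb{R}^n$ given vectors, and $a,b_1,\dots,b_m$, $c_i\le d_i$ ($i=1,\dots,n$) real constants. Consider the primal problem $$(\mathcal{P}):\quad \min\ P(\mathbf{x})=\tfrac12\mathbf{x}^TA\mathbf{x}-\mathbf{a}^T\mathbf{x}-a,\quad \mathbf{x}\in\mathbb{R}^n,$$ subject to $\tfrac12\mathbf{x}^TB_j\mathbf{x}-\mathbf{b}_j^T\mathbf{x}-b_j\le 0$ for $j=1,\dots,m$ and $c_i\le x_i\le d_i$ for $i=1,\dots,n$. For $i=1,\dots,n$ put $B_{m+i}=2E_i$, $\mathbf{b}_{m+i}=(c_i+d_i)\mathbf{e}_i$, $b_{m+i}=-c_id_i$, where $E_i\in\mathbb{R}^{n\times n}$ has a single nonzero entry, equal to $1$, in position $(i,i)$, and $\mathbf{e}_i$ is the $i$-th standard unit vector. For $\boldsymbol\sigma=(\sigma_1,\dots,\sigma_{m+n})\in\mathbb{R}^{m+n}$ let $$G(\boldsymbol\sigma)=A+\sum_{k=1}^{m+n}\sigma_kB_k,\qquad F(\boldsymbol\sigma)=\mathbf{a}+\sum_{k=1}^{m+n}\sigma_k\mathbf{b}_k,\qquad \mathbf{d}=(b_1,\dots,b_{m+n})^T,$$ and let $(\mathcal{P}^d)$ be the canonical dual problem $$(\mathcal{P}^d):\quad \max\Big\{P^d(\boldsymbol\sigma)=-\tfrac12F(\boldsymbol\sigma)^TG(\boldsymbol\sigma)^{\dagger}F(\boldsymbol\sigma)-\boldsymbol\sigma^T\mathbf{d}-a\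 :\ \boldsymbol\sigma\in\mathcal{S}_a^+\Big\},$$ $$\mathcal{S}_a^+=\{\boldsymbol\sigma\in\mathbb{R}^{m+n}:\ \boldsymbol\sigma\ge 0,\ G(\boldsymbol\sigma)\succeq 0\}.$$ Suppose $\bar{\boldsymbol\sigma}$ is a KKT point of $(\mathcal{P}^d)$. (1) If $G(\bar{\boldsymbol\sigma})\succ 0$, then $\bar{\mathbf{x}}=G(\bar{\boldsymbol\sigma})^{-1}F(\bar{\boldsymbol\sigma})$ is the global minimizer of $(\mathcal{P})$. (2) If $\det G(\bar{\boldsymbol\sigma})=0$, then the global minimizer $\bar{\mathbf{x}}$ of $(\mathcal{P})$ is contained in the canonical equilibrium equation $G(\bar{\boldsymbol\sigma})\bar{\mathbf{x}}=F(\bar{\boldsymbol\sigma})$, i.e. it is among the solutions of this equation.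
   Context: $\succeq 0$ and $\succ 0$ mean positive semidefinite and positive definite; vector inequalities are componentwise; $M^\dagger$ is the Moore-Penrose generalized inverse (equal to $M^{-1}$ when $M$ is invertible). A global minimizer of $(\mathcal{P})$ is a feasible point at which $P$ attains its minimum over the feasible set. With $g_k(\mathbf{x})=\tfrac12\mathbf{x}^TB_k\mathbf{x}-\mathbf{b}_k^T\mathbf{x}-b_k$ for $k=1,\dots,m+n$, one has $g_{m+i}(\mathbf{x})=(x_i-c_i)(x_i-d_i)$, so the feasible set of $(\mathcal{P})$ is $\{\mathbf{x}: g_k(\mathbf{x})\le 0,\ k=1,\dots,m+n\}$. The function $P^d$ arises as the stationary value in $\mathbf{x}$ of $\Xi(\mathbf{x},\boldsymbol\sigma)=\tfrac12\mathbf{x}^TG(\boldsymbol\sigma)\mathbf{x}-\mathbf{x}^TF(\boldsymbol\sigma)-\boldsymbol\sigma^T\mathbf{d}-a$; the stationarity condition is the canonical equilibrium equation $G(\boldsymbol\sigma)\mathbf{x}=F(\boldsymbol\sigma)$, which is solved by $\mathbf{x}=G(\boldsymbol\sigma)^\dagger F(\boldsymbol\sigma)$ when $F(\boldsymbol\sigma)$ lies in the column space of $G(\boldsymbol\sigma)$. KKT points of $(\mathcal{P}^d)$ are taken with respect to the Lagrangian $L(\boldsymbol\epsilon,\boldsymbol\sigma)=P^d(\boldsymbol\sigma)-\boldsymbol\epsilon^T\boldsymbol\sigma$, whose multiplier $\boldsymbol\epsilon\in\mathbb{R}^{m+n}$, $\boldsymbol\epsilon\le 0$, is associated with the constraint $\boldsymbol\sigma\ge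 0$: $\bar{\boldsymbol\sigma}\in\mathcal{S}_a^+$ and there is $\boldsymbol\epsilon\le 0$ with $\nabla_{\boldsymbol\sigma}L(\boldsymbol\epsilon,\bar{\boldsymbol\sigma})=0$ and $\epsilon_k\bar\sigma_k=0$ for all $k=1,\dots,m+n$. *)

(* Defs.v *)
From HB Require Import structures.
From mathcomp Require Import all_boot all_order all_algebra.
From mathcomp Require Import all_classical all_reals all_analysis.

Set Implicit Arguments.
Unset Strict Implicit.
Unset Printing Implicit Defensive.

Import Order.TTheory GRing.Theory Num.Theory.
Import numFieldNormedType.Exports.

Local Open Scope ring_scope.
Local Open Scope classical_set_scope.

Definition dot (R : realType) n (u v : 'cV[R]_n) : R := (u^T *m v) 0 0.

Definition vle (R : realType) n (u v : 'cV[R]_n) : Prop :=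
  forall i, u i 0 <= v i 0.

Definition psd (R : realType) n (M : 'M[R]_n) : Prop :=
  M^T = M /\ forall x : 'cV[R]_n, 0 <= dot x (M *m x).

Definition posdef (R : realType) n (M : 'M[R]_n) : Prop :=
  M^T = M /\ forall x : 'cV[R]_n, x != 0 -> 0 < dot x (M *m x).

Definition penrose (R : realType) m n (M : 'M[R]_(m, n)) (X : 'M[R]_(n, m)) :
    Prop :=
  [/\ M *m X *m M = M, X *m M *m X = X,
      (M *m X)^T = M *m X & (X *m M)^T = X *m M].

(* The Moore-Penrose inverse: the default 0 of [xget] is never used, by
   [mpinvP]. The library's [pinvmx] satisfies only part of these equations. *)
Definition mpinv (R : realType) m n (M : 'M[R]_(m, n)) : 'M[R]_(n, m) :=
  xget 0 [set X | penrose M X].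

Lemma gram_unit (R : realType) m n (M : 'M[R]_(m, n)) :
  row_free M -> M *m M^T \in unitmx.
Proof.
move=> freeM; rewrite -row_free_unit -kermx_eq0; apply/rowV0P => v.
move/sub_kermxP; rewrite mulmxA => vMMT.
have vM0 : v *m M = 0.
  have : (v *m M *m (v *m M)^T) 0 0 = 0.
    by rewrite trmx_mul mulmxA vMMT mul0mx mxE.
  rewrite mxE => /eqP; rewrite psumr_eq0 => [|j _]; last first.
    by rewrite [_^T _ _]mxE -expr2 sqr_ge0.
  move=> /allP sq0; apply/rowP => j; rewrite [RHS]mxE.
  have := sq0 j (mem_index_enum _); rewrite [_^T _ _]mxE -expr2 sqrf_eq0.
  by move=> /eqP.
by apply: (row_free_inj freeM); rewrite vM0 mul0mx.
Qed.

Lemma penrose_exists (R : realType) m n (M : 'M[R]_(m, n)) :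
  exists X, penrose M X.
Proof.
have [r [C [S [ME fC fS]]]] : exists r (C : 'M[R]_(m, r)) (S : 'M[R]_(r, n)),
    [/\ M = C *m S, row_free C^T & row_free S].
  exists (\rank M), (col_base M), (row_base M).
  rewrite mulmx_base row_base_free; split=> //.
  by rewrite /row_free mxrank_tr; exact: col_base_full.
have uS : S *m S^T \in unitmx by exact: gram_unit.
have uC : C^T *m C \in unitmx by have := gram_unit fC; rewrite trmxK.
set S' := S^T *m invmx (S *m S^T); set C' := invmx (C^T *m C) *m C^T.
have SS' : S *m S' = 1%:M by rewrite /S' mulmxA mulmxV.
have C'C : C' *m C = 1%:M by rewrite /C' -mulmxA mulVmx.
have MX : M *m (S' *m C') = C *m C'.
  by rewrite ME mulmxA -(mulmxA C) SS' mulmx1.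
have XM : (S' *m C') *m M = S' *m S.
  by rewrite ME mulmxA -(mulmxA S') C'C mulmx1.
exists (S' *m C'); split.
- by rewrite MX ME mulmxA -(mulmxA C) C'C mulmx1.
- by rewrite XM mulmxA -(mulmxA S') SS' mulmx1.
- by rewrite MX /C' !trmx_mul trmx_inv !trmx_mul !trmxK mulmxA.
- by rewrite XM /S' !trmx_mul trmx_inv !trmx_mul !trmxK mulmxA.
Qed.

Lemma penrose_unique (R : realType) m n (M : 'M[R]_(m, n)) X Y :
  penrose M X -> penrose M Y -> X = Y.
Proof.
move=> [MXM XMX sMX sXM] [MYM YMY sMY sYM].
have MXMY : M *m X = M *m Y.
  rewrite -sMX -{1}MYM -mulmxA trmx_mul sMX sMY.
  by rewrite mulmxA MXM.
have XMYM : X *m M = Y *m M.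
  rewrite -sXM -{1}MYM -[M *m Y *m M]mulmxA mulmxA trmx_mul sXM sYM.
  by rewrite -mulmxA [M *m (X *m M)]mulmxA MXM.
by rewrite -XMX -mulmxA MXMY mulmxA XMYM YMY.
Qed.

Lemma mpinvP (R : realType) m n (M : 'M[R]_(m, n)) : penrose M (mpinv M).
Proof. exact: (xgetPex 0 (penrose_exists M)). Qed.

Lemma mpinv_unit (R : realType) n (M : 'M[R]_n) :
  M \in unitmx -> mpinv M = invmx M.
Proof.
move=> uM; apply: (penrose_unique (mpinvP M)).
by split; rewrite ?mulmxV ?mulVmx ?mul1mx ?trmx1.
Qed.

Record qcqp (R : realType) (m n : nat) := QCQP {
  objA : 'M[R]_n;
  obja : 'cV[R]_n;
  objc : R;
  conB : 'I_m -> 'M[R]_n;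
  conb : 'I_m -> 'cV[R]_n;
  conc : 'I_m -> R;
  lob : 'cV[R]_n;
  upb : 'cV[R]_n
}.

Definition primal (R : realType) m n (Q : qcqp R m n) (x : 'cV[R]_n) : R :=
  2^-1 * dot x (objA Q *m x) - dot (obja Q) x - objc Q.

Definition feasible (R : realType) m n (Q : qcqp R m n) (x : 'cV[R]_n) : Prop :=
  (forall j, 2^-1 * dot x (conB Q j *m x) - dot (conb Q j) x - conc Q j <= 0) /\
  (vle (lob Q) x /\ vle x (upb Q)).

Definition global_minimizer (R : realType) m n (Q : qcqp R m n)
    (x : 'cV[R]_n) : Prop :=
  feasible Q x /\ forall y, feasible Q y -> primal Q x <= primal Q y.

(* The constraints indexed by 'I_(m + n): the m given ones, followed by
   (x_i - lob_i) (x_i - upb_i) <= 0 for i < n. *)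
Definition extB (R : realType) m n (Q : qcqp R m n) (k : 'I_(m + n)) : 'M[R]_n :=
  match fintype.split k with
  | inl j => conB Q j
  | inr i => 2 *: delta_mx i i
  end.

Definition extb (R : realType) m n (Q : qcqp R m n) (k : 'I_(m + n)) : 'cV[R]_n :=
  match fintype.split k with
  | inl j => conb Q j
  | inr i => (lob Q i 0 + upb Q i 0) *: delta_mx i 0
  end.

Definition extd (R : realType) m n (Q : qcqp R m n) : 'cV[R]_(m + n) :=
  \col_k match fintype.split k with
         | inl j => conc Q j
         | inr i => - (lob Q i 0 * upb Q i 0)
         end.

Definition dualG (R : realType) m n (Q : qcqp R m n) (s : 'cV[R]_(m + n)) :
    'M[R]_n :=
  objA Q + \sum_(k < m + n) s k 0 *: extB Q k.

Definition dualF (R : realType) m n (Q : qcqp R m n) (s : 'cV[R]_(m + n)) :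
    'cV[R]_n :=
  obja Q + \sum_(k < m + n) s k 0 *: extb Q k.

Definition dualP (R : realType) m n (Q : qcqp R m n) (s : 'cV[R]_(m + n)) : R :=
  - 2^-1 * dot (dualF Q s) (mpinv (dualG Q s) *m dualF Q s)
  - dot s (extd Q) - objc Q.

Definition Sa_plus (R : realType) m n (Q : qcqp R m n) : set 'cV[R]_(m + n) :=
  [set s | vle 0 s /\ psd (dualG Q s)].

Definition lagrangian (R : realType) m n (Q : qcqp R m n)
    (e s : 'cV[R]_(m + n)) : R :=
  dualP Q s - dot e s.

Definition grad (R : realType) n (f : 'cV[R]_n -> R) (x : 'cV[R]_n) :
    'cV[R]_n :=
  \col_k 'D_(delta_mx k 0) f x.

(* [dualP] need not be smooth where [dualG] is singular, so that a vanishing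
   gradient includes (Frechet) differentiability, in the whole space, at s. *)
Definition dual_kkt (R : realType) m n (Q : qcqp R m n)
    (s : 'cV[R]_(m + n)) : Prop :=
  Sa_plus Q s /\
  exists e : 'cV[R]_(m + n),
    [/\ vle e 0,
        differentiable (lagrangian Q e) s,
        grad (lagrangian Q e) s = 0 &
        forall k, e k 0 * s k 0 = 0].

(* Main.v *)
(* Write Xi(x, s) = P(x) + sum_k s_k g_k(x), which is affine in s; where G(s)
   is positive semidefinite, P^d(s) is the minimum of Xi(., s), attained exactly
   on the solutions of G(s) x = F(s) as soon as there are any. At a KKT point s,
   continuity of P^d forces F(s) into the range of G(s). Along every direction d
   making G(s + t d) definite for t > 0, the derivative of P^d is at most
   sum_k d_k g_k(x) for each solution x. In the direction that adds 2 t I to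
   G(s), equality holds for the solution x nearest to the centre of the box.
   Since the derivative is linear in d and this direction is interior, equality
   holds in all directions: g_k(x) = epsilon_k for every k. Hence x is feasible
   and complementary to s, so that P(y) >= Xi(y, s) >= Xi(x, s) = P(x) for
   feasible y, and equality forces G(s) y = F(s). The singular and the definite
   case need no separate treatment. *)
Require Import Defs.
From mathcomp Require Import all_boot all_order all_algebra.
From mathcomp Require Import all_classical all_reals all_analysis.
From mathcomp Require Import ring lra.
Set Implicit Arguments.
Unset Strict Implicit.
Unset Printing Implicit Defensive.

Import Order.TTheory GRing.Theory Num.Theory.
Import numFieldNormedType.Exports.
Local Open Scope ring_scope.

(** * Inner product and positive semidefinite matrices *)

Section Dot.
Context {R : realType} {n : nat}.
Implicit Types (u v w x : 'cV[R]_n) (M : 'M[R]_n).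

Lemma dotE u v : dot u v = \sum_i u i 0 * v i 0.
Proof. by rewrite /dot mxE; apply: eq_bigr => i _; rewrite mxE. Qed.

Lemma dotC u v : dot u v = dot v u.
Proof. by rewrite !dotE; apply: eq_bigr => i _; rewrite mulrC. Qed.

Lemma dotDr u v w : dot u (v + w) = dot u v + dot u w.
Proof. by rewrite /dot mulmxDr mxE. Qed.

Lemma dotDl u v w : dot (u + v) w = dot u w + dot v w.
Proof. by rewrite dotC dotDr !(dotC w). Qed.

Lemma dotZr a u v : dot u (a *: v) = a * dot u v.
Proof. by rewrite /dot -scalemxAr mxE. Qed.

Lemma dotZl a u v : dot (a *: u) v = a * dot u v.
Proof. by rewrite dotC dotZr dotC. Qed.

Lemma dotNr u v : dot u (- v) = - dot u v.
Proof. by rewrite /dot mulmxN mxE. Qed.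

Lemma dotNl u v : dot (- u) v = - dot u v.
Proof. by rewrite dotC dotNr dotC. Qed.

Lemma dot0r u : dot u 0 = 0.
Proof. by rewrite /dot mulmx0 mxE. Qed.

Lemma dot_sumr (I : finType) u (f : I -> 'cV[R]_n) :
  dot u (\sum_i f i) = \sum_i dot u (f i).
Proof. by rewrite /dot mulmx_sumr summxE. Qed.

Lemma dot_mull M u v : dot (M *m u) v = dot u (M^T *m v).
Proof. by rewrite /dot trmx_mul mulmxA. Qed.

Lemma dot_delta u i : dot u (delta_mx i 0) = u i 0.
Proof.
rewrite dotE (bigD1 i) //= mxE !eqxx mulr1 big1 ?addr0 // => j ji.
by rewrite mxE (negPf ji) mulr0.
Qed.

Lemma dot_ge0 u : 0 <= dot u u.
Proof. by rewrite dotE sumr_ge0 // => i _; rewrite -expr2 sqr_ge0. Qed.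

Lemma dot_eq0 u : dot u u = 0 -> u = 0.
Proof.
rewrite dotE => /eqP; rewrite psumr_eq0 => [/allP h|i _]; last first.
  by rewrite -expr2 sqr_ge0.
apply/colP => i; rewrite [RHS]mxE.
by have := h i (mem_index_enum _); rewrite -expr2 sqrf_eq0 => /eqP.
Qed.

Lemma dot_gt0 u : u != 0 -> 0 < dot u u.
Proof.
move=> u0; rewrite lt_neqAle dot_ge0 andbT eq_sym.
by apply: contraNN u0 => /eqP /dot_eq0 ->.
Qed.

Lemma quad_nonneg_lin0 (a b : R) : 0 <= a -> 0 <= b ->
  (forall t, 0 <= - 2 * t * a + t ^+ 2 * b) -> a = 0.
Proof.
(* At this [t] the quadratic equals [- t ^+ 2 * (b + 2)], which forces [t = 0]. *)
move=> a0 b0 h; have := h (a / (b + 1)); set t := a / (b + 1).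
have tb : a = t * (b + 1) by rewrite /t divfK //; lra.
rewrite tb => ht; suff : t ^+ 2 = 0.
  by move/eqP; rewrite sqrf_eq0 => /eqP ->; rewrite mul0r.
have := sqr_ge0 t; nra.
Qed.

Lemma posdef_psd M : posdef M -> psd M.
Proof.
move=> [sM pM]; split=> // x; have [->|/pM/ltW//] := eqVneq x 0.
by rewrite mulmx0 dot0r.
Qed.

Lemma posdef_unitmx M : posdef M -> M \in unitmx.
Proof.
move=> [sM pM]; rewrite -row_free_unit -kermx_eq0; apply/rowV0P => v.
move/sub_kermxP => vM; apply/eqP; rewrite -trmx_eq0; apply/negPn/negP => /pM.
by rewrite -sM -trmx_mul vM trmx0 dot0r ltxx.
Qed.

(** A zero of the form is a minimum, so the first-order term along [M *m x] vanishes; it is a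
    multiple of the squared norm of [M *m x]. *)
Lemma psd_quad0 M x : psd M -> dot x (M *m x) = 0 -> M *m x = 0.
Proof.
move=> [sM pM] x0; apply: dot_eq0.
set w := M *m x; set a := dot w w; set b := dot w (M *m w).
have b0 : 0 <= b := pM w.
have a0 : 0 <= a := dot_ge0 w.
have h t : 0 <= - 2 * t * a + t ^+ 2 * b.
  have := pM (x - t *: w).
  rewrite !(mulmxBr, dotDl, dotDr, dotNl, dotNr) -!scalemxAr !(dotZl, dotZr).
  rewrite x0 -/w -/a -/b.
  have -> : dot x (M *m w) = a by rewrite /a {2}/w dot_mull sM.
  lra.
exact: quad_nonneg_lin0 a0 b0 h.
Qed.

(** [M *m mpinv M] is the orthogonal projector onto the range, whose complement is the kernel of the
    symmetric [M]. *)
Lemma sym_range_kernel M w :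
  M^T = M -> exists z k, w = M *m z + k /\ M *m k = 0.
Proof.
move=> sM; exists (mpinv M *m w), (w - M *m (mpinv M *m w)).
rewrite addrC subrK; split=> //; have [MXM _ sMX _] := mpinvP M.
have MMX : M *m (M *m mpinv M) = M.
  by rewrite -sMX -{1}sM -trmx_mul MXM.
by rewrite mulmxBr !mulmxA -(mulmxA M M) MMX subrr.
Qed.

(** A crude bound that lets the identity absorb a small multiple of any [extB]. *)
Lemma abs_quad_le M x :
  `|dot x (M *m x)| <= (\sum_i \sum_j `|M i j|) * dot x x.
Proof.
rewrite dotE mulr_suml (le_trans (ler_norm_sum _ _ _)) // ler_sum // => i _.
rewrite mxE mulr_sumr mulr_suml (le_trans (ler_norm_sum _ _ _)) //.
have sq k : x k 0 ^+ 2 <= dot x x.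
  rewrite dotE (bigD1 k) //= expr2 lerDl sumr_ge0 // => l _.
  by rewrite -expr2 sqr_ge0.
rewrite ler_sum // => j _; rewrite mulrCA normrM ler_wpM2l // normrM.
have := sq i; have := sq j; rewrite -(real_normK (num_real (x i 0))).
rewrite -(real_normK (num_real (x j 0))) => hj hi.
have := sqr_ge0 (`|x i 0| - `|x j 0|); nra.
Qed.

End Dot.

(** Linearity of the differential carries vanishing partial derivatives over to every direction
    [v]. *)
Lemma differentiable_grad0 (R : realType) n (f : 'cV[R]_n -> R) x v (eps : R) :
  differentiable f x -> grad f x = 0 -> 0 < eps ->
  exists2 t0, 0 < t0 &
    forall t, 0 < t <= t0 -> `|f (x + t *: v) - f x| <= eps * t.
Proof.
move=> df gf eps0.
have dv0 : 'D_v f x = 0.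
  rewrite deriveE // (matrix_sum_delta v) linear_sum big1 //= => i _.
  rewrite big_ord1 linearZ /= -deriveE //.
  by have /colP/(_ i) := gf; rewrite !mxE => ->; rewrite scaler0.
have := @diff_derivable _ _ _ f x v df.
rewrite /derivable => /cvgr_dist_le /(_ _ eps0).
rewrite -[lim _]/('D_v f x) dv0 => /nbhs_ballP[d /= d0 hd].
exists (d / 2); first by rewrite divr_gt0.
move=> t /andP[t0 td]; have := hd t.
rewrite /ball /= sub0r normrN gtr0_norm // sub0r normrN normrZ normfV.
rewrite gtr0_norm //.
rewrite (addrC x) mulrC ler_pdivrMr //.
by apply; rewrite ?gt_eqF //; lra.
Qed.

(** * The extended constraints and the function Xi *)

Definition con {R : realType} {m n} (Q : qcqp R m n) (k : 'I_(m + n))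
    (x : 'cV[R]_n) : R :=
  2^-1 * dot x (extB Q k *m x) - dot (extb Q k) x - extd Q k 0.

Definition xi {R : realType} {m n} (Q : qcqp R m n) (x : 'cV[R]_n)
    (s : 'cV[R]_(m + n)) : R :=
  primal Q x + \sum_k s k 0 * con Q k x.

(* Moving [s] by [t] in this direction turns [dualG] into [dualG + 2 t I]. *)
Definition box_dir (R : realType) m n : 'cV[R]_(m + n) :=
  col_mx 0 (const_mx 1).

Section CanonicalDual.
Context {R : realType} {m n : nat}.
Variable Q : qcqp R m n.
Hypothesis symA : (objA Q)^T = objA Q.
Hypothesis symB : forall j, (conB Q j)^T = conB Q j.
Hypothesis lob_upb : vle (lob Q) (upb Q).
Implicit Types (x y : 'cV[R]_n) (s d e : 'cV[R]_(m + n)).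

Lemma splitl (j : 'I_m) : fintype.split (lshift n j) = inl j.
Proof. exact: (unsplitK (inl j)). Qed.

Lemma splitr (i : 'I_n) : fintype.split (rshift m i) = inr i.
Proof. exact: (unsplitK (inr i)). Qed.

Lemma con_lshift j x : con Q (lshift n j) x =
  2^-1 * dot x (conB Q j *m x) - dot (conb Q j) x - conc Q j.
Proof. by rewrite /con /extB /extb !mxE !splitl. Qed.

Lemma extB_rshift i x : dot x (extB Q (rshift m i) *m x) = 2 * x i 0 ^+ 2.
Proof.
rewrite /extB splitr -scalemxAl dotZr; congr (_ * _).
have -> : delta_mx i i *m x = x i 0 *: delta_mx i 0.
  apply/colP => j; rewrite !mxE (bigD1 i) //= !mxE !eqxx !andbT big1 ?addr0.
    by rewrite mulrC.
  by move=> l li; rewrite mxE (negPf li) andbF mul0r.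
by rewrite dotZr dot_delta.
Qed.

Lemma con_rshift i x :
  con Q (rshift m i) x = (x i 0 - lob Q i 0) * (x i 0 - upb Q i 0).
Proof.
by rewrite /con extB_rshift /extb !mxE !splitr dotZl dotC dot_delta; field.
Qed.

(** The factored constraints describe the box because the bounds are ordered. *)
Lemma con_feasible x : (forall k, con Q k x <= 0) <-> feasible Q x.
Proof.
split=> [h|[hc [hl hu]] k]; first split=> [j|].
- by rewrite -con_lshift.
- split=> i; have := h (rshift m i); rewrite con_rshift; have := lob_upb i; nra.
- case: (split_ordP k) => [j|i] ->; first by rewrite con_lshift.
  by rewrite con_rshift mulr_ge0_le0 // ?subr_ge0 ?subr_le0.
Qed.

Lemma dualG_sym s : (dualG Q s)^T = dualG Q s.
Proof.
rewrite /dualG linearD /= symA linear_sum; congr (_ + _).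
apply: eq_bigr => k _; rewrite linearZ /=; congr (_ *: _); rewrite /extB.
by case: (fintype.split k) => [j|i]; rewrite ?symB // linearZ /= trmx_delta.
Qed.

Lemma dualG_addZ s t d :
  dualG Q (s + t *: d) = dualG Q s + t *: \sum_k d k 0 *: extB Q k.
Proof.
rewrite /dualG; under eq_bigr => k _ do rewrite !mxE scalerDl -scalerA.
by rewrite big_split /= -scaler_sumr addrA.
Qed.

Lemma xi_addZ x s t d :
  xi Q x (s + t *: d) = xi Q x s + t * \sum_k d k 0 * con Q k x.
Proof.
rewrite /xi; under eq_bigr => k _ do rewrite !mxE mulrDl -mulrA.
by rewrite big_split /= -mulr_sumr addrA.
Qed.

Lemma xiE x s : xi Q x s =
  2^-1 * dot x (dualG Q s *m x) - dot (dualF Q s) x - dot s (extd Q) - objc Q.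
Proof.
rewrite /xi /primal /dualG /dualF mulmxDl mulmx_suml dotDr dot_sumr dotDl.
rewrite (dotC (\sum_k _)) dot_sumr [dot s _]dotE.
under [X in _ + X = _]eq_bigr => k _.
  rewrite /con mulrBr mulrBr mulrCA; over.
rewrite !sumrB -mulr_sumr.
under [X in 2^-1 * (_ + X)]eq_bigr => k _ do rewrite -scalemxAl dotZr.
under [X in _ - (_ + X)]eq_bigr => k _ do rewrite dotZr dotC.
ring.
Qed.

(** The term linear in [y] vanishes, [x] being stationary. *)
Lemma xi_shift x y s : dualG Q s *m x = dualF Q s ->
  xi Q (x + y) s = xi Q x s + 2^-1 * dot y (dualG Q s *m y).
Proof.
move=> Gx; rewrite !xiE -Gx mulmxDr !(dotDl, dotDr).
rewrite (dotC (dualG Q s *m x) y) (dotC x (_ *m y)) dot_mull.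
by rewrite dualG_sym; field.
Qed.

(** The identity [M *m mpinv M *m M = M] makes the choice among the solutions immaterial. *)
Lemma dualP_xi x s : dualG Q s *m x = dualF Q s -> dualP Q s = xi Q x s.
Proof.
move=> Gx; rewrite xiE /dualP -Gx dot_mull dualG_sym !mulmxA.
by have [-> _ _ _] := mpinvP (dualG Q s); rewrite dot_mull dualG_sym; field.
Qed.

Lemma dualP_le_xi x s : posdef (dualG Q s) -> dualP Q s <= xi Q x s.
Proof.
move=> pG; have uG := posdef_unitmx pG.
have Gz : dualG Q s *m (invmx (dualG Q s) *m dualF Q s) = dualF Q s.
  by rewrite mulmxA mulmxV // mul1mx.
rewrite (dualP_xi Gz) -(subrK (invmx (dualG Q s) *m dualF Q s) x) addrC.
by rewrite (xi_shift _ Gz) lerDl mulr_ge0 // (posdef_psd pG).2.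
Qed.

(** * Directions that make [dualG] definite *)

Lemma box_dir_sum (f : 'I_(m + n) -> R) :
  \sum_k box_dir R m n k 0 * f k = \sum_i f (rshift m i).
Proof.
rewrite big_split_ord /= big1 ?add0r => [|j _]; last first.
  by rewrite /box_dir col_mxEu mxE mul0r.
by apply: eq_bigr => i _; rewrite /box_dir col_mxEd mxE mul1r.
Qed.

Lemma box_dir_con x :
  \sum_k box_dir R m n k 0 * con Q k x = dot (x - lob Q) (x - upb Q).
Proof.
rewrite box_dir_sum dotE; apply: eq_bigr => i _.
by rewrite con_rshift !mxE.
Qed.

Lemma box_dir_quad x :
  \sum_k box_dir R m n k 0 * dot x (extB Q k *m x) = 2 * dot x x.
Proof.
rewrite box_dir_sum dotE mulr_sumr; apply: eq_bigr => i _.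
by rewrite extB_rshift expr2.
Qed.

Lemma posdef_dir s t d : psd (dualG Q s) -> 0 < t ->
  (forall x, dot x x <= \sum_k d k 0 * dot x (extB Q k *m x)) ->
  posdef (dualG Q (s + t *: d)).
Proof.
move=> [_ pG] t0 hd; split=> [|x x0]; first exact: dualG_sym.
rewrite dualG_addZ mulmxDl dotDr ltr_wpDl // -scalemxAl dotZr mulr_gt0 //.
rewrite mulmx_suml dot_sumr (lt_le_trans (dot_gt0 x0)) //.
by under eq_bigr => k _ do rewrite -scalemxAl dotZr.
Qed.

Lemma posdef_box_dir s t : psd (dualG Q s) -> 0 < t ->
  posdef (dualG Q (s + t *: box_dir R m n)).
Proof.
move=> pG t0; apply: posdef_dir => // x; rewrite box_dir_quad.
by have := dot_ge0 x; lra.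
Qed.

(** * One-sided slopes of the dual function *)

Definition ray_slope s d (a : R) := forall eps : R, 0 < eps ->
  exists2 t0, 0 < t0 & forall t, 0 < t <= t0 ->
    `|dualP Q (s + t *: d) - dualP Q s - t * a| <= eps * t.

(** The Lagrangian is flat to first order at [s], so the multiplier term alone gives the slope. *)
Lemma kkt_ray_slope s e d :
  differentiable (lagrangian Q e) s -> grad (lagrangian Q e) s = 0 ->
  ray_slope s d (dot e d).
Proof.
move=> dL gL eps eps0; have [t0 t00 h] := differentiable_grad0 d dL gL eps0.
exists t0 => // t /h; rewrite /lagrangian dotDr dotZr.
by congr (`|_| <= _); ring.
Qed.

Lemma ray_slope_ge s d (a b M : R) : ray_slope s d a ->
  (forall t, 0 < t -> dualP Q s + t * b - t ^+ 2 * M <= dualP Q (s + t *: d)) ->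
  b <= a.
Proof.
move=> ha hb; apply/ler_addgt0Pr => eps eps0.
have [t0 t00 h] := ha (eps / 2) (divr_gt0 eps0 (ltr0n _ 2)).
(* The second argument keeps the quadratic error below [t * eps / 2]; the added 1 guards against
   [M = 0]. *)
pose t := Num.min t0 (eps / (2 * (`|M| + 1))).
have M1 : 0 < `|M| + 1 by have := normr_ge0 M; lra.
have tgt0 : 0 < t by rewrite lt_min t00 divr_gt0 // mulr_gt0.
have tM : t * `|M| <= eps / 2.
  have : t <= eps / (2 * (`|M| + 1)) by rewrite ge_min lexx orbT.
  rewrite ler_pdivlMr ?mulr_gt0 //; lra.
have tt0 : 0 < t <= t0 by rewrite tgt0 ge_min lexx.
have := h t tt0; rewrite ler_norml => /andP[_ h2].
have h1 := hb t tgt0; have h3 : t * (b - eps / 2 - a - t * M) <= 0 by lra.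
have : b - eps / 2 - a - t * M <= 0 by rewrite -(pmulr_rle0 _ tgt0).
have : t * M <= t * `|M| by rewrite ler_wpM2l ?ler_norm ?ltW.
lra.
Qed.

Lemma ray_slope_le s d (a b : R) : ray_slope s d a ->
  (forall t, 0 < t -> dualP Q (s + t *: d) <= dualP Q s + t * b) -> a <= b.
Proof.
move=> ha hb; apply/ler_addgt0Pr => eps eps0.
have [t t0 h] := ha eps eps0.
have tt : 0 < t <= t by rewrite t0 lexx.
have := h t tt; rewrite ler_norml => /andP[h1 _].
have h2 := hb t t0.
by rewrite -(ler_pM2l t0); lra.
Qed.

(* Testing [xi] on multiples of a kernel vector [k] shows that [dualP] would
   jump at [s] if [dualF] had a component along [k]. *)
Lemma dualF_range s a : psd (dualG Q s) -> ray_slope s (box_dir R m n) a ->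
  exists x, dualG Q s *m x = dualF Q s.
Proof.
move=> pG ha; have [z [k [Fzk Gk]]] :=
  sym_range_kernel (dualF Q s) (dualG_sym s).
suff : k = 0 by move=> k0; exists z; rewrite Fzk k0 addr0.
have Fk : dot (dualF Q s) k = dot k k.
  by rewrite Fzk dotDl dot_mull dualG_sym Gk dot0r add0r.
have key (al : R) : dualP Q s <= xi Q (al *: k) s.
  set y := al *: k; set b := \sum_k box_dir R m n k 0 * con Q k y.
  apply/ler_addgt0Pr => eps eps0.
  (* Tolerance 1 suffices: the change of [dualP] only has to be of order [t]. *)
  have [t0 t00 h] := ha 1 ltr01.
  have C0 : 0 < `|a| + `|b| + 1.
    by have := normr_ge0 a; have := normr_ge0 b; lra.
  pose t := Num.min t0 (eps / (`|a| + `|b| + 1)).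
  have tgt0 : 0 < t by rewrite lt_min t00 divr_gt0.
  have tC : t * (`|a| + `|b| + 1) <= eps.
    by rewrite -ler_pdivlMr // ge_min lexx orbT.
  have tt0 : 0 < t <= t0 by rewrite tgt0 ge_min lexx.
  have := h t tt0; rewrite ler_norml => /andP[h1 h2].
  have := dualP_le_xi y (posdef_box_dir pG tgt0); rewrite xi_addZ -/b => h3.
  have h4 : t * b <= t * `|b| by rewrite ler_wpM2l ?ler_norm ?ltW.
  have h5 : - (t * a) <= t * `|a|.
    by rewrite -mulrN -normrN ler_wpM2l ?ler_norm ?ltW.
  lra.
apply: dot_eq0; apply/eqP/negPn/negP => k0.
(* This multiple of [k] brings [xi] down to [dualP Q s - 1], against [key]. *)
have := key ((xi Q 0 s - dualP Q s + 1) / dot k k).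
rewrite xiE -scalemxAr Gk scaler0 dot0r mulr0 dotZr Fk divfK //.
by rewrite xiE mulmx0 !dot0r; lra.
Qed.

(** * Recovering a primal point from the slopes *)

Lemma ray_slope_box_lower s a : psd (dualG Q s) ->
  ray_slope s (box_dir R m n) a -> exists x, dualG Q s *m x = dualF Q s /\
    \sum_k box_dir R m n k 0 * con Q k x <= a.
Proof.
move=> pG ha; have [x0 Gx0] := dualF_range pG ha.
have [z [k [wzk Gk]]] :=
  sym_range_kernel (lob Q + upb Q - 2 *: x0) (dualG_sym s).
(* [x] is the solution of [dualG *m x = dualF] nearest to the box centre, so
   that their difference lies in the range of [dualG]: this makes the error in
   the lower bound quadratic in [t]. *)
have [x Gx xz] : exists2 x, dualG Q s *m x = dualF Q s &
    2 *: x = lob Q + upb Q - dualG Q s *m z.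
  exists (x0 + 2^-1 *: k); first by rewrite mulmxDr -scalemxAr Gk scaler0 addr0.
  rewrite scalerDr scalerA divff // scale1r.
  apply/eqP; rewrite eq_sym subr_eq -addrA (addrC k) -wzk.
  by rewrite [eqbRHS]addrC subrK.
exists x; split=> //.
apply: (@ray_slope_ge s _ a _ (2^-1 * dot z (dualG Q s *m z)) ha) => t t0.
set st := s + t *: _; have pGt : posdef (dualG Q st) by exact: posdef_box_dir.
pose xt := invmx (dualG Q st) *m dualF Q st.
have Gxt : dualG Q st *m xt = dualF Q st.
  by rewrite mulmxA mulmxV ?mul1mx ?posdef_unitmx.
have [y xty] : exists y, xt = x + y.
  by exists (xt - x); rewrite addrC subrK.
rewrite (dualP_xi Gxt) (dualP_xi Gx) xty xi_addZ (xi_shift _ Gx).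
rewrite !box_dir_con.
have -> : dot (x + y - lob Q) (x + y - upb Q) =
    dot (x - lob Q) (x - upb Q) + dot y y - dot y (dualG Q s *m z).
  have -> : dualG Q s *m z = lob Q + upb Q - 2 *: x.
    by rewrite xz opprB addrC subrK.
  rewrite !(dotDl, dotDr, dotNl, dotNr, dotZr) (dotC (lob Q) y) (dotC x y).
  ring.
(* Completing the square: the cross term [t * dot y (dualG Q s *m z)] is absorbed at the cost of the
   [t ^+ 2] term. *)
have := pG.2 (y - t *: z).
rewrite !(mulmxBr, dotDl, dotDr, dotNl, dotNr) -!scalemxAr !(dotZl, dotZr).
rewrite (dotC z (_ *m y)) dot_mull dualG_sym.
have := mulr_ge0 (ltW t0) (dot_ge0 y).
lra.
Qed.

Lemma kkt_point_primal s e : psd (dualG Q s) ->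
  differentiable (lagrangian Q e) s -> grad (lagrangian Q e) s = 0 ->
  exists x, dualG Q s *m x = dualF Q s /\ forall k, con Q k x = e k 0.
Proof.
move=> pG dL gL; have slope d := kkt_ray_slope d dL gL.
have [x [Gx hx]] := ray_slope_box_lower pG (slope (box_dir R m n)).
exists x; split=> // k.
(* The bound of [abs_quad_le], increased by 1 so that [c] can be inverted. *)
pose c : R := (\sum_i \sum_j `|extB Q k i j|) + 1.
have c0 : 0 < c by rewrite ltr_wpDl // sumr_ge0 // => i _; rewrite sumr_ge0.
have sum_dir (f : 'I_(m + n) -> R) (eta : R) :
    \sum_l (box_dir R m n + eta *: delta_mx k 0) l 0 * f l =
    \sum_l box_dir R m n l 0 * f l + eta * f k.
  under eq_bigr => l _ do rewrite mxE mulrDl.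
  rewrite big_split /=; congr (_ + _); rewrite (bigD1 k) //= big1 ?addr0.
    by rewrite !mxE !eqxx mulr1.
  by move=> l lk; rewrite !mxE (negPf lk) mulr0 mul0r.
(* For small [eta] of either sign the direction [box_dir + eta e_k] still makes
   [dualG] definite; the inequality being tight at [eta = 0], both signs
   together force equality in coordinate [k]. *)
have le_eta (eta : R) : `|eta| * c <= 1 -> eta * e k 0 <= eta * con Q k x.
  move=> eta_c; pose d := box_dir R m n + eta *: delta_mx k 0.
  have : dot e d <= \sum_l d l 0 * con Q l x.
    apply: (ray_slope_le (slope d)) => t t0.
    rewrite (dualP_xi Gx) -xi_addZ dualP_le_xi //; apply: posdef_dir => // y.
    (* Of the [2 * dot y y] due to [box_dir], one half absorbs the term in [eta] and the other is
       left for definiteness. *)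
    rewrite sum_dir box_dir_quad.
    have := abs_quad_le (extB Q k) y; set q := dot y _ => hq.
    have : `|eta * q| <= dot y y.
      rewrite normrM; have := dot_ge0 y; have := normr_ge0 eta.
      have := ler_wpM2l (normr_ge0 eta) hq.
      rewrite mulrA /c in eta_c *; nra.
    by rewrite ler_norml => /andP[]; lra.
  by rewrite sum_dir dotDr dotZr dot_delta; lra.
apply/eqP; rewrite eq_le; apply/andP; split.
  have := le_eta (- c^-1).
  rewrite normrN gtr0_norm ?invr_gt0 // mulVf ?gt_eqF //.
  by move=> /(_ (lexx _)); rewrite !mulNr lerN2 ler_pM2l ?invr_gt0.
have := le_eta c^-1; rewrite gtr0_norm ?invr_gt0 // mulVf ?gt_eqF //.
by move=> /(_ (lexx _)); rewrite ler_pM2l ?invr_gt0.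
Qed.

(** * Global optimality in the primal problem *)

Lemma kkt_global_minimizer s : dual_kkt Q s ->
  (exists x, global_minimizer Q x) /\
  forall x, global_minimizer Q x -> dualG Q s *m x = dualF Q s.
Proof.
move=> [[s0 pG] [e [e0 dL gL es]]].
have [x [Gx gx]] := kkt_point_primal pG dL gL.
have fx : feasible Q x.
  by apply/con_feasible => k; rewrite gx; have := e0 k; rewrite mxE.
have xi_x : xi Q x s = primal Q x.
  by rewrite /xi big1 ?addr0 // => k _; rewrite gx mulrC es.
(* Weak duality with its quadratic remainder retained: the remainder must vanish at every minimizer,
   which makes it a solution. *)
have lower y : feasible Q y ->
    primal Q x + 2^-1 * dot (y - x) (dualG Q s *m (y - x)) <= primal Q y.
  move=> /con_feasible fy; rewrite -xi_x -xi_shift // addrC subrK /xi.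
  rewrite gerDl sumr_le0 // => k _; rewrite mulr_ge0_le0 //.
  by have := s0 k; rewrite mxE.
split=> [|y [fy miny]].
  exists x; split=> // y /lower; apply: le_trans.
  by rewrite lerDl mulr_ge0 // pG.2.
suff /(psd_quad0 pG) : dot (y - x) (dualG Q s *m (y - x)) = 0.
  by rewrite mulmxBr Gx => /eqP; rewrite subr_eq0 => /eqP.
by have := miny x fx; have := lower y fy; have := pG.2 (y - x); lra.
Qed.

End CanonicalDual.

Theorem theorem1 (R : realType) (m n : nat) (Q : qcqp R m n)
    (symA : (objA Q)^T = objA Q)
    (symB : forall j : 'I_m, (conB Q j)^T = conB Q j)
    (lob_upb : vle (lob Q) (upb Q))
    (s : 'cV[R]_(m + n)) (kkt_s : dual_kkt Q s) :
  (posdef (dualG Q s) ->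
     global_minimizer Q (invmx (dualG Q s) *m dualF Q s) /\
     forall x : 'cV[R]_n, global_minimizer Q x ->
       x = invmx (dualG Q s) *m dualF Q s) /\
  (\det (dualG Q s) = 0 ->
     (exists x : 'cV[R]_n, global_minimizer Q x) /\
     forall x : 'cV[R]_n, global_minimizer Q x ->
       dualG Q s *m x = dualF Q s).
Proof.
have [ex_min sol] := kkt_global_minimizer symA symB lob_upb kkt_s.
split=> [/posdef_unitmx uG|_]; last by [].
have uniq x : global_minimizer Q x -> x = invmx (dualG Q s) *m dualF Q s.
  by move=> /sol <-; rewrite mulKmx.
(* Some minimizer exists and equals the formula, which is therefore a minimizer. *)
by split=> //; have [x minx] := ex_min; rewrite -(uniq x minx).
Qed.
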